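(* For an arbitrary fixed order, if $OPT(I)=3$ then $FF(I)\le 6$. Together with the cases $OPT(I)\le2$, first-fit satisfies $FF(I)\le 2\,OPT(I)$ on all instances with $OPT(I)\le 3$.
   Context: Fixed order scheduling with deadlines: there are jobs $J=\{1,\dots,n\}$, each job $j$ having a processing time $p_j\in\mathbb{N}$, $p_j>0$, and a deadline $d_j\in\mathbb{N}$ with $d_j\ge p_j$ (no other assumption relating order, deadlines, or processing times). All jobs are released at time $0$; job $j$ precedes job $k$ in the fixed order iff $j<k$. A schedule $\tau:J\to\{1,\dots,n\}$ assigns jobs to identical machines; each machine processes its jobs in the fixed order from time $0$ without idle time or preemption, so job $j$ completes at $\sum_{k\le j,\tau(k)=\tau(j)}p_k$; it is feasible if every job completes by its deadline. $OPT(I)$ is the minimum number of machines used by a feasible schedule. First-fit (FF): machines indexed $1,2,\dots$; process jobs in the fixed order and assign each job $j$ to the smallest-index machine whose current load (sum of processing times already assigned) plus $p_j$ is at most $d_j$; $FF(I)$ is the number of nonempty machines. *)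

(* Defs.v *)
From mathcomp Require Import all_boot.
Set Implicit Arguments. Unset Strict Implicit. Unset Printing Implicit Defensive.

(* An instance is a sequence of jobs (p_j, d_j) listed in the fixed order;
   job j (0-based index) precedes job k iff j < k. *)
Definition job := (nat * nat)%type.
Definition ptime (s : seq job) (j : nat) : nat := (nth (0,0) s j).1.
Definition dline (s : seq job) (j : nat) : nat := (nth (0,0) s j).2.

Definition valid_instance (s : seq job) : Prop :=
  forall j, j < size s -> 0 < ptime s j /\ ptime s j <= dline s j.

(* A schedule assigns each of the n jobs to one of n machines ('I_n plays the
   role of {1,...,n}). *)
Definition schedule (s : seq job) := {ffun 'I_(size s) -> 'I_(size s)}.

Definition completion (s : seq job) (tau : schedule s) (j : 'I_(size s)) : nat :=
  \sum_(k < size s | (k <= j) && (tau k == tau j)) ptime s k.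

Definition feasible (s : seq job) (tau : schedule s) : bool :=
  [forall j, completion tau j <= dline s j].

Definition nmachines (s : seq job) (tau : schedule s) : nat :=
  #|[set tau j | j : 'I_(size s)]|.

(* OPT(I): minimum number of machines over feasible schedules
   (the schedule putting every job on its own machine is feasible for a valid
   instance, so the default value size s is never strictly below the min). *)
Definition OPT (s : seq job) : nat :=
  \big[minn/size s]_(tau : schedule s | feasible tau) nmachines tau.

(* First-fit: loads of the opened machines, machine 1 first. *)
Definition ff_step (loads : seq nat) (jb : job) : seq nat :=
  let i := find (fun l => l + jb.1 <= jb.2) loads in
  if i < size loads then set_nth 0 loads i (nth 0 loads i + jb.1)
  else rcons loads jb.1.

(* number of nonempty machines = number of opened machines *)
Definition FF (s : seq job) : nat := size (foldl ff_step [::] s).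

(* Main.v *)
(** Replay first-fit and an optimal schedule side by side. If job [n] lies on
    optimal machine [tau n] and on first-fit machine [ff n], then each first-fit
    machine of smaller index, having rejected the job, is strictly more loaded
    than [tau n]; nothing else about deadlines is needed.

    Suppose the 7th first-fit machine is opened at level [x] of optimal machine
    [a], so that six first-fit machines (numbered from 0) exceed [x]. A job of
    the most loaded optimal machine always lands on machines 0, 1, 2. Let the
    crossing job of an optimal machine be the one passing a given level. If [c]
    crosses with a job starting at [y] and machines 0, 1, 2 later exceed [w],
    then their load without the jobs of [c] from the crossing on exceeds
    [w + min w y], and even [2 w + y] if the crossing job is on a machine
    numbered at least 3.

    If some job starting above [x] in the optimal schedule lies on a machine
    numbered at least 3, take the last one, on optimal machine [b]. The estimate
    at its level shows that machines 3, 4, 5 carry together less than [a], and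
    afterwards only [a] feeds machines 4 and 5, so these cannot both exceed [x].
    Otherwise machines 3, 4, 5 contain only the crossing jobs of [b] and [c] and
    jobs of the initial volume [x + y_b + y_c], and the estimate at the later
    crossing job shows that this volume is too small. *)
Require Import Defs.
From mathcomp Require Import all_boot.
From mathcomp Require Import zify.

Set Implicit Arguments. Unset Strict Implicit. Unset Printing Implicit Defensive.

(** * Processing volume of a set of jobs *)

Definition vol (p : nat -> nat) (P : pred nat) (n : nat) : nat :=
  \sum_(k < n | P k) p k.

Lemma vol0 p P : vol p P 0 = 0.
Proof. by rewrite /vol big_ord0. Qed.

Lemma volS p (P : pred nat) n :
  vol p P n.+1 = vol p P n + (if P n then p n else 0).
Proof. by rewrite /vol big_mkcond big_ord_recr /= -big_mkcond. Qed.

Lemma vol_mono p P n k : n <= k -> vol p P n <= vol p P k.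
Proof.
move=> /subnK <-; elim: (k - n) => [//|d IH].
by rewrite addSn volS; lia.
Qed.

Lemma sub_vol p (P Q : pred nat) n :
  (forall k, k < n -> P k -> Q k) -> vol p P n <= vol p Q n.
Proof.
elim: n => [|n IH] H; first by rewrite !vol0.
rewrite !volS; have := IH (fun k kn => H k (ltnW kn)).
by have := H n (ltnSn n); case: (P n); case: (Q n); lia.
Qed.

Lemma eq_vol p (P Q : pred nat) n :
  (forall k, k < n -> P k = Q k) -> vol p P n = vol p Q n.
Proof.
by move=> H; apply/eqP; rewrite eqn_leq; apply/andP; split; apply: sub_vol => k kn; rewrite H.
Qed.

Lemma vol_or p (P Q : pred nat) n :
  vol p (fun k => P k || Q k) n <= vol p P n + vol p Q n.
Proof.
elim: n => [|n IH]; first by rewrite !vol0.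
by rewrite !volS /=; case: (P n); case: (Q n) => /=; lia.
Qed.

Lemma vol_cut p (P : pred nat) q n :
  q <= n -> vol p (fun k => P k && (k < q)) n = vol p P q.
Proof.
move=> qn; rewrite -(subnK qn); elim: (n - q) => [|d IH].
  by apply: eq_vol => k kq; rewrite kq andbT.
by rewrite addSn volS IH; have -> : (d + q < q) = false by [lia]; rewrite andbF addn0.
Qed.

Lemma vol_split6 p (f : nat -> nat) (Q : pred nat) n :
  vol p (fun k => (f k == 0) && Q k) n + vol p (fun k => (f k == 1) && Q k) n +
  vol p (fun k => (f k == 2) && Q k) n + vol p (fun k => (f k == 3) && Q k) n +
  vol p (fun k => (f k == 4) && Q k) n + vol p (fun k => (f k == 5) && Q k) n
  <= vol p Q n.
Proof.
elim: n => [|n IH]; first by rewrite !vol0.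
rewrite !volS; move: IH; case: (Q n); rewrite ?andbF ?andbT; last by lia.
by case: (f n) => [|[|[|[|[|[|k]]]]]] /=; lia.
Qed.

(** * Loads of two assignments of the same jobs *)

Section Run.

Variables (p tau ff : nat -> nat).

Definition optload a n := vol p (fun k => tau k == a) n.
Definition ffload i n := vol p (fun k => ff k == i) n.

Definition rejects n := forall i, i < ff n -> optload (tau n) n < ffload i n.

Lemma optloadS a n : optload a n.+1 = optload a n + (if tau n == a then p n else 0).
Proof. exact: volS. Qed.

Lemma ffloadS i n : ffload i n.+1 = ffload i n + (if ff n == i then p n else 0).
Proof. exact: volS. Qed.

(** The value [q = n] encodes that [b] does not exceed [x] by time [n]. *)
Lemma optload_cross b x n :
  exists q, [/\ q <= n, optload b q <= x &
                q < n -> tau q = b /\ x < optload b q.+1].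
Proof.
elim: n => [|n [q [qn qx qP]]]; first by exists 0; rewrite /optload vol0.
case: (ltnP q n) => [qn'|nq].
  by exists q; split=> // [|_]; [exact: leqW | exact: qP].
have ? : q = n by lia.
subst q; case: (leqP (optload b n.+1) x) => h.
  by exists n.+1; split=> //; rewrite ltnn.
exists n; split=> // _; split=> //; apply/eqP; move: h qx; rewrite optloadS.
by case: eqP; lia.
Qed.

(** * Load estimates after a crossing job *)

Definition before c q i n :=
  vol p (fun k => (ff k == i) && ~~ ((tau k == c) && (q <= k))) n.
Definition since c q i n :=
  vol p (fun k => (ff k == i) && ((tau k == c) && (q <= k))) n.

Lemma ffload_split c q i n : ffload i n = before c q i n + since c q i n.
Proof.
elim: n => [|n IH]; first by rewrite /ffload /before /since !vol0.
rewrite ffloadS /before /since !volS -/(before _ _ _ _) -/(since _ _ _ _) IH.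
by case: (ff n == i); case: (tau n == c); case: (q <= n) => /=; lia.
Qed.

Lemma beforeS c q i n : before c q i n.+1 = before c q i n +
  (if (ff n == i) && ~~ ((tau n == c) && (q <= n)) then p n else 0).
Proof. exact: volS. Qed.

Lemma sinceS c q i n : since c q i n.+1 = since c q i n +
  (if (ff n == i) && ((tau n == c) && (q <= n)) then p n else 0).
Proof. exact: volS. Qed.

Lemma since_start c q i : since c q i q = 0.
Proof.
have -> : since c q i q = vol p pred0 q.
  by apply: eq_vol => k kq; rewrite [q <= k]leqNgt kq !andbF.
by rewrite /vol big_pred0.
Qed.

Lemma since_le c q n : q <= n ->
  since c q 0 n + since c q 1 n + since c q 2 n + optload c q <= optload c n.
Proof.
move=> /subnK <-; elim: (n - q) => [|d IH]; first by rewrite add0n !since_start.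
rewrite addSn !sinceS optloadS; move: IH.
have -> : q <= d + q by lia.
case: (tau _ == c); rewrite /= ?andbF ?andbT; last by lia.
by case: (ff _) => [|[|[|k]]] /=; lia.
Qed.

(** The crossing job lies outside machines 0, 1, 2, so the bound improves by its processing time. *)
Lemma since_le_high c q n : tau q = c -> 2 < ff q -> q < n ->
  since c q 0 n + since c q 1 n + since c q 2 n + optload c q.+1 <= optload c n.
Proof.
move=> tq fq /subnK <-; elim: (n - q.+1) => [|d IH].
  rewrite add0n !sinceS !since_start tq eqxx leqnn.
  by case: (ff q) fq => [|[|[|k]]].
rewrite addSn !sinceS (optloadS _ (d + q.+1)); move: IH.
have -> : q <= d + q.+1 by lia.
case: (tau _ == c); rewrite /= ?andbF ?andbT; last by lia.
by case: (ff _) => [|[|[|k]]] /=; lia.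
Qed.

(* Once a job of [c] enters machine 1 (or 2), the machines before it exceed the
   load of [c], which bounds what [c] itself put there; hence the rest of their
   load is large. *)
Lemma cross_low_inv c q n : (forall k, k < n -> rejects k) ->
  tau q = c -> ff q < 3 -> q < n ->
  let y := optload c q in let e := optload c q.+1 in
  [\/ since c q 1 n = 0 /\ since c q 2 n = 0,
      y < before c q 0 n /\ since c q 2 n = 0,
      [/\ y < before c q 0 n, y < before c q 1 n, since c q 1 n = 0
        & e <= y + since c q 2 n]
    | e + y < before c q 0 n + before c q 1 n].
Proof.
move=> + tq fq qn y e; move: qn => /subnK <-; elim: (n - q.+1) => [|d IH] rej.
  have rq i : i < ff q -> y < before c q i q.
    move=> iq; have := rej q (leqnn _) i iq.
    by rewrite tq (ffload_split c q) since_start addn0.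
  rewrite add0n !sinceS !since_start !beforeS tq eqxx leqnn !andbF /= !addn0 !add0n.
  rewrite /e optloadS tq eqxx -/y; case: (ff q) fq rq => [|[|[|//]]] _ rq /=.
  - by constructor 1.
  - by constructor 2; split=> //; apply: rq.
  (* The third alternative arises only here, from a crossing job on machine 2. *)
  - by constructor 3; split=> //; apply: rq.
have rn := rej (d + q.+1) (leqnn _).
have {}IH := IH (fun k kn => rej k (ltnW kn)).
rewrite addSn; set k := d + q.+1 in rn IH *.
have qk : q < k by rewrite /k; lia.
have gle := since_le c (ltnW qk); rewrite -/y in gle.
have ele : e <= optload c k by apply: vol_mono.
move: rn; rewrite /rejects.
have := (ffload_split c q 0 k, ffload_split c q 1 k).
rewrite !beforeS !sinceS (ltnW qk) andbT.
case: (tau k =P c) => [->|_]; rewrite /= ?andbF ?andbT ?addn0; last first.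
  by move=> _ _; case: IH => [[]|[]|[]|] *; [constructor 1|constructor 2|constructor 3|constructor 4]; try split; lia.
case: (ff k) => [|[|[|j]]] [l0 l1] h /=; rewrite ?addn0.
- by [].
- have := h 0 isT => {}h.
  case: IH => [[]|[]|[]|] *.
  + by constructor 2; lia.
  + by constructor 2; lia.
  + by constructor 4; lia.
  + by constructor 4; lia.
(* Machines 0 and 1 both exceed [optload c k], and [c] put at most [optload c k - y] there since
   [q]. *)
- have := h 0 isT; have := h 1 isT => {}h h'.
  by constructor 4; lia.
- by [].
Qed.

(** A machine that received no job of [c] from [q] on has more than [w] in [before]. If only machine
    0 received some, machines 1 and 2 give [2 w]; the other alternatives give [w + optload c q],
    hence the minimum. *)
Lemma cross_low c q n w : (forall k, k < n -> rejects k) ->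
  tau q = c -> ff q < 3 -> q < n -> w <= optload c q.+1 ->
  (forall i, i < 3 -> w < ffload i n) ->
  w + minn w (optload c q) < before c q 0 n + before c q 1 n + before c q 2 n.
Proof.
move=> rej tq fq qn we Hw; have := cross_low_inv rej tq fq qn.
have := (Hw 0 isT, Hw 1 isT, Hw 2 isT); rewrite !(ffload_split c q).
by move=> [[]] ? ? ? H; case: H => [[]|[]|[]|]; lia.
Qed.

(** As in [cross_low_inv], but machines 0, 1, 2 all rejected the crossing job and so exceed [y] from
    the start, and [since_le_high] turns bounds in [y] into bounds in [e]. *)
Lemma cross_high_inv c q n : (forall k, k < n -> rejects k) ->
  tau q = c -> 2 < ff q -> q < n ->
  let y := optload c q in let e := optload c q.+1 in
  [/\ y < before c q 0 n, y < before c q 1 n, y < before c q 2 n &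
   [\/ since c q 1 n = 0 /\ since c q 2 n = 0,
       e < before c q 0 n /\ since c q 2 n = 0
     | e + e < before c q 0 n + before c q 1 n]].
Proof.
move=> + tq fq qn y e; move: qn => /subnK <-; elim: (n - q.+1) => [|d IH] rej.
  have rq i : i < 3 -> y < before c q i q.
    move=> i3; have := rej q (leqnn _) i (leq_trans i3 fq).
    by rewrite tq (ffload_split c q) since_start addn0.
  rewrite add0n !sinceS !since_start !beforeS tq eqxx leqnn !andbF /= !addn0.
  have [-> ->] : ff q == 1 = false /\ ff q == 2 = false by lia.
  by split; try exact: rq; constructor 1.
have rn := rej (d + q.+1) (leqnn _).
have {}IH := IH (fun k kn => rej k (ltnW kn)).
rewrite addSn; set k := d + q.+1 in rn IH *.
have qk : q < k by rewrite /k; lia.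
have gle := since_le_high tq fq qk; rewrite -/e in gle.
have ele : e <= optload c k by apply: vol_mono.
move: rn; rewrite /rejects.
have := (ffload_split c q 0 k, ffload_split c q 1 k).
case: IH => b0 b1 b2 IH.
rewrite !beforeS !sinceS (ltnW qk) andbT.
case: (tau k =P c) => [->|_]; rewrite /= ?andbF ?andbT ?addn0; last first.
  move=> _ _; split; try lia.
  by case: IH => [[]|[]|] *; [constructor 1|constructor 2|constructor 3]; try split; lia.
case: (ff k) => [|[|[|j]]] [l0 l1] h /=; rewrite ?addn0; split=> //.
- have := h 0 isT => {}h.
  case: IH => [[]|[]|] *.
  + by constructor 2; lia.
  + by constructor 2; lia.
  + by constructor 3; lia.
- have := h 0 isT; have := h 1 isT => {}h h'.
  by constructor 3; lia.
Qed.

Lemma cross_high c q n w : (forall k, k < n -> rejects k) ->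
  tau q = c -> 2 < ff q -> q < n -> w <= optload c q.+1 ->
  (forall i, i < 3 -> w < ffload i n) ->
  w + w + optload c q < before c q 0 n + before c q 1 n + before c q 2 n.
Proof.
move=> rej tq fq qn we Hw; have [] := cross_high_inv rej tq fq qn.
have := (Hw 0 isT, Hw 1 isT, Hw 2 isT); rewrite !(ffload_split c q).
by move=> [[]] ? ? ? ? ? ? H; case: H => [[]|[]|]; lia.
Qed.

Lemma ffload_sum n :
  ffload 0 n + ffload 1 n + ffload 2 n + ffload 3 n + ffload 4 n + ffload 5 n
  <= vol p predT n.
Proof.
apply: leq_trans (vol_split6 p ff predT n); apply: eq_leq.
by do ![congr (_ + _)]; apply: eq_vol => k _; rewrite andbT.
Qed.

Lemma ffload_early i (Q : pred nat) n :
  (forall k, k < n -> ff k = i -> Q k) ->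
  ffload i n <= vol p (fun k => (ff k == i) && Q k) n.
Proof. by move=> H; apply: sub_vol => k kn /eqP fk; rewrite fk eqxx (H k). Qed.

(** * Two optimal machines *)

Section TwoMachines.

Variables a b : nat.
Hypothesis cover : forall k, (tau k == a) || (tau k == b).

Lemma total_le2 n : vol p predT n <= optload a n + optload b n.
Proof.
apply: leq_trans (vol_or _ _ _ _).
by apply: sub_vol => k _ _; apply: cover.
Qed.

(** Apart from the crossing job of [b], machines 2 and 3 hold only jobs of the initial volume
    [x + y]. Either both exceed [x] within it, or one holds the crossing job, and then machines 0
    and 1 exceed [y] within it. *)
Lemma two_machines N : (forall k, k < N -> rejects k) ->
  ~ (forall i, i < 4 -> optload a N < ffload i N).
Proof.
move=> rej Hx; set x := optload a N in Hx.
have [q [qN yx qP]] := optload_cross b x N.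
set y := optload b q in yx.
pose Q k := (tau k == a) || ((tau k == b) && (k < q)).
pose E i := vol p (fun k => (ff k == i) && Q k) N.
have total : E 0 + E 1 + E 2 + E 3 <= x + y.
  have : vol p Q N <= x + y.
    by apply: leq_trans (vol_or _ _ _ _) _; rewrite vol_cut.
  by have := vol_split6 p ff Q N; rewrite /E; lia.
have low k : k < N -> tau k = b -> q < k -> ff k < 2.
  move=> kN tk qk; case: ltnP => // fk; exfalso.
  have [_ xe] := qP (ltn_trans qk kN).
  have := rej k kN; rewrite /rejects tk => r.
  have r0 := r 0 (ltnW fk); have r1 := r 1 fk.
  have ? : optload b q.+1 <= optload b k by apply: vol_mono.
  have ? : optload a k <= x by apply: vol_mono; lia.
  by have := ffload_sum k; have := total_le2 k; lia.
have big i : 1 < i -> i < 4 -> x < E i \/ q < N /\ ff q = i.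
  move=> i1 i4; case: (boolP ((q < N) && (ff q == i))) => [/andP[? /eqP ?]|nq]; [by right|left].
  apply: leq_trans (Hx i i4) _; apply: ffload_early => k kN fk.
  rewrite /Q; case/orP: (cover k) => [->//|tk]; rewrite tk orbC /=.
  case: (ltngtP k q) => //= [qk|kq].
    by have := low k kN (eqP tk) qk; lia.
  by move: nq; rewrite -kq kN fk eqxx.
have := big 2 isT isT; have := big 3 isT isT.
case: (leqP 2 (ff q)) => [fq|]; last by lia.
case: (ltnP q N) => [q_lt|]; last by lia.
have [tq _] := qP q_lt.
have early i : i < 2 -> y < E i.
  move=> i2; have := rej q q_lt i (leq_trans i2 fq); rewrite tq -/y => h.
  apply: leq_trans h _; apply: leq_trans (vol_mono _ _ qN).
  apply: ffload_early => k kq _; rewrite /Q kq andbT; exact: cover.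
by have := early 0 isT; have := early 1 isT; lia.
Qed.

End TwoMachines.

(** * Three optimal machines *)

Section ThreeMachines.

Variables a b c : nat.
Hypothesis cover : forall k, [|| tau k == a, tau k == b | tau k == c].

Lemma total_le3 n :
  vol p predT n <= optload a n + optload b n + optload c n.
Proof.
rewrite -addnA.
apply: leq_trans (leq_add (leqnn _) (vol_or _ _ _ _)).
apply: leq_trans (vol_or _ _ _ _).
by apply: sub_vol => k _ _; apply: cover.
Qed.

(** Otherwise machines 0, 1, 2 would each exceed the largest optimal load, and jointly the total
    volume. *)
Lemma max_machine_low n : rejects n ->
  optload a n <= optload (tau n) n -> optload b n <= optload (tau n) n ->
  optload c n <= optload (tau n) n -> ff n < 3.
Proof.
move=> r ha hb hc; case: ltnP => // fn; exfalso.
have r0 := r 0 (ltnW (ltnW fn)); have r1 := r 1 (ltnW fn); have r2 := r 2 fn.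
by have := ffload_sum n; have := total_le3 n; lia.
Qed.

(* [k] is the last job on a machine numbered at least 3 that starts above the
   final level of [a] in the optimal schedule. *)
Lemma last_late N k : (forall k, k < N -> rejects k) ->
  k < N -> tau k = b -> 2 < ff k -> optload a N < optload b k ->
  (forall j, k < j -> j < N -> 2 < ff j -> optload (tau j) j <= optload a N) ->
  ffload 4 N + ffload 5 N <= optload a N.
Proof.
move=> rej kN tk fk; set x := optload a N => xz last.
set z := optload b k in xz.
have rejk j : j < k -> rejects j by move=> jk; apply: rej; lia.
have ax : optload a k <= x by apply: vol_mono; lia.
have zc : z < optload c k.
  case: ltnP => // cz; exfalso.
  by have := max_machine_low (rej k kN); rewrite tk -/z; lia.
have [q [qk yz qP]] := optload_cross c z k.
have q_lt : q < k.
  by rewrite ltn_neqAle qk andbT; apply/eqP=> qe; move: yz; rewrite qe; lia.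
have [tq ze] := qP q_lt.
set y := optload c q in yz.
have total : before c q 0 k + before c q 1 k + before c q 2 k +
   before c q 3 k + before c q 4 k + before c q 5 k <= optload a k + z + y.
  apply: leq_trans (vol_split6 p ff _ k) _.
  rewrite -addnA -[y](vol_cut p (fun k => tau k == c) qk).
  apply: leq_trans (leq_add (leqnn _) (vol_or _ _ _ _)).
  apply: leq_trans (vol_or _ _ _ _).
  apply: sub_vol => j jk; rewrite ltnNge; move: (cover j).
  by case: (tau j == a); case: (tau j == b); case: (tau j == c); case: (q <= j).
have Hz i : i < 3 -> z < ffload i k.
  by move=> i3; have := rej k kN i (leq_trans i3 fk); rewrite tk.
case: (ltnP 2 (ff q)) => fq.
  by have := cross_high rejk tq fq q_lt (ltnW ze) Hz; lia.
have := cross_low rejk tq fq q_lt (ltnW ze) Hz.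
rewrite -/y => E3.
have late i : 2 < i -> since c q i k = 0.
  move=> i2; have -> : since c q i k = vol p pred0 k; last by rewrite /vol big_pred0.
  apply: eq_vol => j jk; apply/negP => /and3P[/eqP fj /eqP tj qj].
  case: (ltngtP q j) qj => // [qj|qe] _; last by move: fq; rewrite qe; lia.
  have := max_machine_low (rejk j jk); rewrite tj fj.
  have ? : optload c q.+1 <= optload c j by apply: vol_mono.
  have ? : optload a j <= optload a k by apply: vol_mono; lia.
  have ? : optload b j <= z by apply: vol_mono; lia.
  by lia.
have L i : 2 < i -> ffload i k = before c q i k.
  by move=> i2; rewrite (ffload_split c q) late // addn0.
(* By [total] and [E3], machine 3 holds less than [optload a k], which is below [z], so it cannot
   have rejected [k]. *)
have fk3 : ff k = 3.
  apply/eqP; rewrite eqn_leq fk andbT leqNgt; apply/negP => fk3.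
  have := rej k kN 3 fk3; rewrite tk -/z L //; lia.
suff H n : k <= n -> n <= N ->
    ffload 4 n + ffload 5 n + optload a k <= ffload 4 k + ffload 5 k + optload a n.
  by have := H N (ltnW kN) (leqnn _); rewrite (L 4) // (L 5) // -/x; lia.
move=> /subnK <-; elim: (n - k) => [//|d IH]; rewrite addSn => dN.
move: (IH (ltnW dN)); rewrite !ffloadS optloadS.
(* [last] speaks only of jobs after [k]; job [k] itself is on machine 3. *)
case: (posnP d) => [->|d0]; first by rewrite add0n fk3 /=; lia.
set j := d + k.
have lj := last j; case: (ltnP 2 (ff j)) => fj; last first.
  by have -> : ff j == 4 = false by [lia]; have -> : ff j == 5 = false by [lia]; lia.
have {}lj : optload (tau j) j <= x by apply: lj => //; rewrite /j; lia.
have ? : z <= optload b j by apply: vol_mono; rewrite /j; lia.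
have ? : optload c k <= optload c j by apply: vol_mono; rewrite /j; lia.
have -> : tau j == a.
  by case/or3P: (cover j) => // /eqP tj; exfalso; move: lj; rewrite tj; lia.
by case: (ff j) => [|[|[|[|[|[|i]]]]]] /=; lia.
Qed.

(* [qb] and [qc] are the crossing jobs of [b] and [c], or [N] if there is none.
   By symmetry [c] is the machine whose crossing job lies on a machine numbered
   at least 3, the later one if both do. *)
Lemma no_late N qb qc : (forall k, k < N -> rejects k) ->
  let x := optload a N in
  (forall i, i < 6 -> x < ffload i N) ->
  (forall k, k < N -> 2 < ff k -> optload (tau k) k <= x) ->
  [/\ qb <= N, optload b qb <= x & qb < N -> tau qb = b /\ x < optload b qb.+1] ->
  [/\ qc <= N, optload c qc <= x & qc < N -> tau qc = c /\ x < optload c qc.+1] ->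
  (qb < N -> ff qb < 3) /\ (qc < N -> ff qc < 3) \/
  [/\ qc < N, 2 < ff qc & [\/ qb < qc, qb = N | ff qb < 3]] -> False.
Proof.
move=> rej x Hx nolate [qbN ybx qbP] [qcN ycx qcP] order.
set yb := optload b qb in ybx; set yc := optload c qc in ycx.
pose Q k := [|| tau k == a, (tau k == b) && (k < qb) | (tau k == c) && (k < qc)].
pose E i := vol p (fun k => (ff k == i) && Q k) N.
have total : E 0 + E 1 + E 2 + E 3 + E 4 + E 5 <= x + (yb + yc).
  apply: leq_trans (vol_split6 p ff Q N) _.
  rewrite -[yc](vol_cut p (fun k => tau k == c) qcN).
  rewrite -[yb](vol_cut p (fun k => tau k == b) qbN).
  apply: leq_trans (leq_add (leqnn _) (vol_or _ _ _ _)).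
  exact: vol_or.
have big i : 2 < i -> i < 6 -> [\/ x < E i, qb < N /\ ff qb = i | qc < N /\ ff qc = i].
  move=> i2 i6.
  case: (boolP ((qc < N) && (ff qc == i))) => [/andP[? /eqP ?]|nqc]; first by constructor 3.
  case: (boolP ((qb < N) && (ff qb == i))) => [/andP[? /eqP ?]|nqb]; first by constructor 2.
  constructor 1; apply: leq_trans (Hx i i6) _; apply: ffload_early => k kN fk.
  have lk : optload (tau k) k <= x by apply: nolate; rewrite ?fk.
  rewrite /Q; case/or3P: (cover k) => [->//|tk|tk]; rewrite tk /=.
  - case: (ltngtP k qb) => [_|qk|kq]; first (by rewrite orbT); exfalso; last first.
      by move: nqb; rewrite -kq kN fk eqxx.
    have [_ xe] := qbP (ltn_trans qk kN).
    have ? : optload b qb.+1 <= optload b k by apply: vol_mono.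
    by move: lk; rewrite (eqP tk); lia.
  - case: (ltngtP k qc) => [_|qk|kq]; first (by rewrite !orbT); exfalso; last first.
      by move: nqc; rewrite -kq kN fk eqxx.
    have [_ xe] := qcP (ltn_trans qk kN).
    have ? : optload c qc.+1 <= optload c k by apply: vol_mono.
    by move: lk; rewrite (eqP tk); lia.
have := big 3 isT isT; have := big 4 isT isT; have := big 5 isT isT => {big} big5 big4 big3.
case: order => [[nb nc]|[qc_lt fqc order]].
  (* Machines 3, 4, 5 each exceed [x] within a volume of at most [3 x]. *)
  by case: big3 => [?|[]|[]]; case: big4 => [?|[]|[]]; case: big5 => [?|[]|[]]; lia.
have [tqc xec] := qcP qc_lt.
have Hy i : i < 3 -> yc < ffload i qc.
  by move=> i3; have := rej qc qc_lt i (leq_trans i3 fqc); rewrite tqc.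
case: (ltnP qb qc) => [qbc|qcb]; last first.
  (* All jobs before [qc] satisfy [Q], so machines 0, 1, 2 give more than [3 yc], and two of
     machines 3, 4, 5 more than [2 x]. *)
  have early i : i < 3 -> yc < E i.
    move=> i3; apply: leq_trans (Hy i i3) _; apply: leq_trans (vol_mono _ _ qcN).
    apply: ffload_early => k kq _; rewrite /Q kq (leq_trans kq qcb) !andbT; exact: cover.
  have := early 0 isT; have := early 1 isT; have := early 2 isT.
  by case: big3 => [?|[]|[]]; case: big4 => [?|[]|[]]; case: big5 => [?|[]|[]]; case: order; lia.
have qb_lt : qb < N by lia.
have [tqb xeb] := qbP qb_lt.
have early i : before b qb i qc <= E i.
  apply: leq_trans (vol_mono _ _ qcN); apply: sub_vol => k kq.
  rewrite /Q kq (ltnNge k qb); case/andP=> -> /=; move: (cover k).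
  by case: (tau k == a); case: (tau k == b); case: (tau k == c); case: (qb <= k).
have rejc k : k < qc -> rejects k by move=> ?; apply: rej; lia.
have := early 0; have := early 1; have := early 2 => e2 e1 e0.
have web : yc <= optload b qb.+1 by lia.
(* If both crossing jobs are high, one of machines 3, 4, 5 still exceeds [x] within [Q], and
   [2 yc + yb] from [cross_high] suffices. Otherwise two of them do, and [yc] from [cross_low]
   suffices. *)
case: (ltnP 2 (ff qb)) => fqb.
  have := cross_high rejc tqb fqb qbc web Hy; rewrite -/yb.
  by case: big3 => [?|[]|[]]; case: big4 => [?|[]|[]]; case: big5 => [?|[]|[]]; lia.
have := cross_low rejc tqb fqb qbc web Hy; rewrite -/yb.
by case: big3 => [?|[]|[]]; case: big4 => [?|[]|[]]; case: big5 => [?|[]|[]]; lia.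
Qed.

End ThreeMachines.

Lemma three_machines a b c N : b != c ->
  (forall k, [|| tau k == a, tau k == b | tau k == c]) ->
  (forall k, k < N -> rejects k) ->
  ~ (forall i, i < 6 -> optload a N < ffload i N).
Proof.
move=> bc cover rej Hx.
have cover' k : [|| tau k == a, tau k == c | tau k == b].
  by have := cover k; rewrite [(tau k == b) || _]orbC.
pose P k := [&& k < N, 2 < ff k & optload a N < optload (tau k) k].
case: (boolP (has P (iota 0 N))) => [/hasP[k0 _ Pk0]|/hasPn noP].
  have ubP k : P k -> k <= N by case/andP=> /ltnW.
  case: (ex_maxnP (ex_intro P k0 Pk0) ubP) => k /and3P[kN fk xk] kmax.
  have last j : k < j -> j < N -> 2 < ff j -> optload (tau j) j <= optload a N.
    move=> kj jN fj; rewrite leqNgt; apply/negP => xj.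
    by have := kmax j; rewrite /P jN fj xj => /(_ isT); lia.
  have h4 := Hx 4 isT; have h5 := Hx 5 isT.
  case/or3P: (cover k) => /eqP tk; rewrite tk in xk.
  - have : optload a k <= optload a N by apply: vol_mono; lia.
    by lia.
  - by have := last_late cover rej kN tk fk xk last; lia.
  - by have := last_late cover' rej kN tk fk xk last; lia.
have nolate k : k < N -> 2 < ff k -> optload (tau k) k <= optload a N.
  move=> kN fk; rewrite leqNgt; apply/negP => xk.
  by have := noP k; rewrite mem_iota /P kN fk xk => /(_ isT).
have [qb Cb] := optload_cross b (optload a N) N.
have [qc Cc] := optload_cross c (optload a N) N.
have H := no_late cover rej Hx nolate Cb Cc.
have H' := no_late cover' rej Hx nolate Cc Cb.
case: Cb Cc => qbN _ Pb [qcN _ Pc].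
case: (boolP ((qb < N) && (2 < ff qb))) => [/andP[qb_lt fb]|nb];
  case: (boolP ((qc < N) && (2 < ff qc))) => [/andP[qc_lt fc]|nc].
- case: (ltngtP qb qc) => qbc.
  + by apply: H; right; split=> //; constructor 1.
  + by apply: H'; right; split=> //; constructor 1.
  + by case: (Pb qb_lt) (Pc qc_lt) => tb _ [tc _]; move: bc; rewrite -tb -tc qbc eqxx.
- apply: H'; right; split=> //.
  by case: (ltnP qc N) => ?; [constructor 3 | constructor 2]; lia.
- apply: H; right; split=> //.
  by case: (ltnP qb N) => ?; [constructor 3 | constructor 2]; lia.
- by apply: H; left; split=> ?; lia.
Qed.

Lemma ff_lt6 N : (forall k, k <= N -> rejects k) -> (forall k, tau k < 3) -> ff N < 6.
Proof.
move=> rej t3; case: ltnP => // fN; exfalso.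
have Hx i : i < 6 -> optload (tau N) N < ffload i N.
  by move=> i6; apply: (rej N) => //; apply: leq_trans fN.
have rejN k : k < N -> rejects k by move=> kN; apply: rej; apply: ltnW.
have cover k : [|| tau k == 0, tau k == 1 | tau k == 2] by have := t3 k; lia.
case: (tau N) (t3 N) Hx => [|[|[|//]]] _ Hx.
- exact: (@three_machines 0 1 2 N).
- by apply: (@three_machines 1 0 2 N) => // k; have := cover k; lia.
- by apply: (@three_machines 2 0 1 N) => // k; have := cover k; lia.
Qed.

Lemma ff_lt4 N : (forall k, k <= N -> rejects k) -> (forall k, tau k < 2) -> ff N < 4.
Proof.
move=> rej t2; case: ltnP => // fN; exfalso.
have Hx i : i < 4 -> optload (tau N) N < ffload i N.
  by move=> i4; apply: (rej N) => //; apply: leq_trans fN.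
have rejN k : k < N -> rejects k by move=> kN; apply: rej; apply: ltnW.
case: (tau N) (t2 N) Hx => [|[|//]] _ Hx.
- by apply: (@two_machines 0 1 _ N) => // k; have := t2 k; lia.
- by apply: (@two_machines 1 0 _ N) => // k; have := t2 k; lia.
Qed.

Lemma ff_lt1 N : rejects N -> (forall k, tau k < 1) -> ff N < 1.
Proof.
move=> rej t1; case: ltnP => // fN; exfalso.
have := rej 0 fN; rewrite ltnNge => /negP; apply.
by apply: sub_vol => k _ _; have := t1 k; have := t1 N; lia.
Qed.

End Run.

(** * First-fit against a feasible schedule *)

Definition ff_loads (s : seq job) n := foldl ff_step [::] (take n s).

Definition ff_machine (s : seq job) n :=
  find (fun l => l + ptime s n <= dline s n) (ff_loads s n).

Lemma ff_loadsS s n : n < size s ->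
  ff_loads s n.+1 = ff_step (ff_loads s n) (nth (0, 0) s n).
Proof. by move=> ns; rewrite /ff_loads (take_nth (0, 0) ns) foldl_rcons. Qed.

Lemma nth_ff_step l (jb : job) i :
  nth 0 (ff_step l jb) i =
  nth 0 l i + (if find (fun x => x + jb.1 <= jb.2) l == i then jb.1 else 0).
Proof.
rewrite /ff_step; set f := find _ _; case: ltnP => fl.
  by rewrite nth_set_nth /= eq_sym; case: eqP => [->|_] //; rewrite addn0.
have -> : f = size l by apply/eqP; rewrite eqn_leq fl find_size.
rewrite nth_rcons; case: (ltngtP i (size l)) => h; first by rewrite addn0.
  by rewrite nth_default // ltnW.
by rewrite h nth_default.
Qed.

Lemma ffload_ff_loads s n i : n <= size s ->
  ffload (ptime s) (ff_machine s) i n = nth 0 (ff_loads s n) i.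
Proof.
elim: n => [|n IH] ns; first by rewrite /ffload vol0 /ff_loads take0 nth_nil.
by rewrite ffloadS IH ?(ltnW ns) // ff_loadsS // nth_ff_step.
Qed.

Lemma size_ff_loads s K n : n <= size s ->
  (forall k, k < n -> ff_machine s k < K) -> size (ff_loads s n) <= K.
Proof.
elim: n => [|n IH] ns fK; first by rewrite /ff_loads take0.
have {}IH := IH (ltnW ns) (fun k kn => fK k (ltnW kn)).
rewrite ff_loadsS // /ff_step; case: ltnP => h.
  by rewrite size_set_nth; move/maxn_idPr: h => ->.
rewrite size_rcons; apply: leq_ltn_trans h _; exact: (fK n).
Qed.

Lemma FF_le s K : (forall k, k < size s -> ff_machine s k < K) -> FF s <= K.
Proof. by move/(size_ff_loads (leqnn _)); rewrite /ff_loads take_size. Qed.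

Lemma FF_le_size s : FF s <= size s.
Proof.
suff H n : n <= size s -> size (ff_loads s n) <= n.
  by have := H _ (leqnn _); rewrite /ff_loads take_size.
elim: n => [|n IH] ns; first by rewrite /ff_loads take0.
have {}IH := IH (ltnW ns); rewrite ff_loadsS // /ff_step; case: ltnP => h.
  by rewrite size_set_nth; move/maxn_idPr: h => ->; apply: leqW.
by rewrite size_rcons.
Qed.

(* The machines used by [t] are renumbered 0, 1, ... so that they form an
   initial segment of [nat]; indices beyond the last job get the junk value 0. *)
Definition opt_machine s (t : schedule s) n :=
  if insub n is Some j then index (t j) (enum [set t j | j : 'I_(size s)]) else 0.

Lemma opt_machine_ord s (t : schedule s) (j : 'I_(size s)) :
  opt_machine t j = index (t j) (enum [set t j | j : 'I_(size s)]).
Proof. by rewrite /opt_machine valK. Qed.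

(** As there is a job, the set of used machines is nonempty, so even the junk value 0 is below its
    size. *)
Lemma opt_machine_lt s (t : schedule s) n :
  0 < size s -> opt_machine t n < nmachines t.
Proof.
move=> s0; have in_t j : t j \in enum [set t j | j : 'I_(size s)].
  by rewrite mem_enum; apply: imset_f.
rewrite /nmachines cardE /opt_machine; case: insub => [j|]; first by rewrite index_mem.
by have := in_t (Ordinal s0); case: (enum _).
Qed.

Lemma optload_completion s (t : schedule s) (j : 'I_(size s)) :
  optload (ptime s) (opt_machine t) (opt_machine t j) j.+1 = completion t j.
Proof.
rewrite /optload /vol /completion.
rewrite (big_ord_widen_cond _ (fun k => opt_machine t k == opt_machine t j)
  (ptime s) (ltn_ord j)).
apply: eq_bigl => k; rewrite andbC ltnS; congr (_ && _).
rewrite !opt_machine_ord; apply/eqP/eqP => [|->] //.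
have in_t i : t i \in enum [set t j | j : 'I_(size s)].
  by rewrite mem_enum; apply: imset_f.
by move/(congr1 (nth (t k) (enum [set t j | j : 'I_(size s)]))); rewrite !nth_index.
Qed.

(** Job [n] meets its deadline on its optimal machine and would miss it on each first-fit machine
    passed over; cancelling its processing time compares the loads. *)
Lemma feasible_rejects s (t : schedule s) n : feasible t -> n < size s ->
  rejects (ptime s) (opt_machine t) (ff_machine s) n.
Proof.
move=> /forallP feas ns i fi; have := feas (Ordinal ns).
rewrite -optload_completion optloadS eqxx ffload_ff_loads ?(ltnW ns) //=.
by have := before_find 0 fi; lia.
Qed.

Lemma OPT_attained s :
  OPT s = size s \/ exists2 t : schedule s, feasible t & nmachines t = OPT s.
Proof.
rewrite /OPT; elim/big_rec: _ => [|t x ft IH]; first by left.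
by rewrite /minn; case: ltnP => _ //; right; exists t.
Qed.

Lemma FF_le_nmachines s (t : schedule s) : feasible t -> nmachines t <= 3 ->
  FF s <= 2 * nmachines t.
Proof.
move=> feas m3; case: (posnP (size s)) => [s0|s0].
  by have := FF_le_size s; rewrite s0; lia.
have lt k := opt_machine_lt t k s0.
have rej k : k < size s -> forall j, j <= k ->
    rejects (ptime s) (opt_machine t) (ff_machine s) j.
  by move=> ks j jk; apply: feasible_rejects => //; apply: leq_ltn_trans ks.
apply: FF_le => k ks.
case: (nmachines t) m3 lt => [|[|[|[|//]]]] _ lt.
- by have := lt 0.
- by have := ff_lt1 (rej k ks k (leqnn _)) lt; lia.
- exact: ff_lt4 (rej k ks) lt.
- exact: ff_lt6 (rej k ks) lt.
Qed.

Theorem mainTheorem9 :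
  forall s : seq job, valid_instance s ->
    (OPT s = 3 -> FF s <= 6) /\ (OPT s <= 3 -> FF s <= 2 * OPT s).
Proof.
move=> s _.
suff H : OPT s <= 3 -> FF s <= 2 * OPT s.
  by split=> // opt3; have := H; rewrite opt3 => /(_ isT).
case: (OPT_attained s) => [->|[t feas <-]]; last exact: FF_le_nmachines.
(* The default [size s] of the minimum is harmless: first-fit opens at most one machine per job. *)
by move=> _; have := FF_le_size s; lia.
Qed.
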